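(* Let $d\ge 1$, $N\ge 1$, $\delta>0$ and assume that $h:(-\pi-\delta,\pi+\delta)\times\mathbb{R}^{d}\rightarrow\mathbb{C}$ is a polyharmonic function of order $N$ which is odd at $t=0$ and at $t=\pm\pi$. For each integer $k\ge 1$ and $y\in\mathbb{R}^d$ let $$a_{k}(y)=\frac{1}{\pi}\int_{-\pi}^{\pi}h(t,y)\sin(kt)\,dt$$ be the Fourier (sine) coefficients of the function $H_y(t):=h(t,y)$ on $[-\pi,\pi]$. Then $a_k$ satisfies the equation $$\left(\Delta_{y}-k^{2}\right)^{N}a_{k}(y)=0\quad\text{for all }y\in\mathbb{R}^d.$$
   Context: A function $f:G\to\mathbb{C}$ on a domain $G$ in a Euclidean space is polyharmonic of order $N$ if it is $2N$ times continuously differentiable and $\Delta^{N}f=0$ on $G$, where $\Delta$ is the Laplace operator in all variables. Here the variables are $(t,y)$ with $y\in\mathbb{R}^d$, $\Delta=\partial_t^2+\Delta_y$, and $\Delta_y$ is the Laplacian in $y$. A function $u:(a,b)\times\mathbb{R}^{d}\to\mathbb{C}$ is odd at $t_{0}\in(a,b)$ if $u(t_{0}+t,y)=-u(t_{0}-t,y)$ for all $|t|<\min\{b-t_{0},t_{0}-a\}$ and all $y\in\mathbb{R}^{d}$. *)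

(* Defs.v *)
From HB Require Import structures.
From mathcomp Require Import all_boot all_order all_algebra.
From mathcomp Require Import all_classical all_reals all_analysis.
From mathcomp.real_closed Require Import complex.

Set Implicit Arguments.
Unset Strict Implicit.
Unset Printing Implicit Defensive.

Import Order.TTheory GRing.Theory Num.Theory.
Import numFieldNormedType.Exports.

Local Open Scope classical_set_scope.
Local Open Scope ring_scope.
Local Open Scope complex_scope.

(* Limits of complex-valued functions of real variables are taken
   componentwise: [R[i]] has no [normedModType R] instance. Functions are
   total, and only their values on the (open) set [G] matter below. *)

Section complex_valued_calculus.
Context {R : realType} {V : normedModType R}.
Implicit Types (f : V -> R[i]) (G : set V).

Definition cre f : V -> R := fun x => complex.Re (f x).

Definition cim f : V -> R := fun x => complex.Im (f x).

Definition ccontinuous_on G f : Prop :=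
  forall x, G x -> {for x, continuous (cre f)} /\ {for x, continuous (cim f)}.

Definition cderivable f (x v : V) : Prop :=
  derivable (cre f) x v /\ derivable (cim f) x v.

Definition cderive (v : V) f : V -> R[i] :=
  fun x => 'D_v (cre f) x +i* 'D_v (cim f) x.

(* The family [e] is the coordinate basis of [V], so that [cderive (e i)] is
   the i-th partial derivative. *)
Context {I : finType}.
Implicit Type e : I -> V.

Fixpoint Cn_on e (n : nat) G f : Prop :=
  if n is m.+1 then
    [/\ ccontinuous_on G f,
        forall i x, G x -> cderivable f x (e i)
      & forall i, Cn_on e m G (cderive (e i) f)]
  else ccontinuous_on G f.

Definition laplacian e f : V -> R[i] :=
  fun x => \sum_(i : I) cderive (e i) (cderive (e i) f) x.

Definition polyharmonic e (N : nat) G f : Prop :=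
  Cn_on e (2 * N) G f /\ forall x, G x -> iter N (laplacian e) f x = 0.

Definition helmholtz e (k : nat) f : V -> R[i] :=
  fun x => laplacian e f x - k%:R ^+ 2 * f x.

End complex_valued_calculus.

Definition y_basis {R : realType} {d : nat} (j : 'I_d) : 'rV[R]_d :=
  delta_mx 0 j.

(* [None] stands for the variable t and [Some j] for y_j. *)
Definition ty_basis {R : realType} {d : nat} (i : option 'I_d) :
    (R * 'rV[R]_d)%type :=
  if i is Some j then (0, y_basis j) else (1, 0).

Definition strip {R : realType} {d : nat} (a b : R) : set (R * 'rV[R]_d) :=
  [set p | a < p.1 < b].

Definition odd_at {R : realType} {d : nat} (a b t0 : R)
    (u : R * 'rV[R]_d -> R[i]) : Prop :=
  forall (t : R) (y : 'rV[R]_d),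
    `|t| < Num.min (b - t0) (t0 - a) -> u (t0 + t, y) = - u (t0 - t, y).

Definition cintegral {R : realType} (D : set R) (g : R -> R[i]) : R[i] :=
  (\int[@lebesgue_measure R]_(t in D) complex.Re (g t)) +i*
  (\int[@lebesgue_measure R]_(t in D) complex.Im (g t)).

Definition sine_coef {R : realType} {d : nat} (h : R * 'rV[R]_d -> R[i])
    (k : nat) (y : 'rV[R]_d) : R[i] :=
  (pi^-1)%:C *
  cintegral `[- pi, pi]%classic (fun t => h (t, y) * (sin (k%:R * t))%:C).

(* Main.v *)
Require Import Defs.
From mathcomp Require Import all_boot all_order all_algebra.
From mathcomp Require Import all_classical all_reals all_analysis ring lra.
From mathcomp.real_closed Require Import complex.
Import Order.TTheory GRing.Theory Num.Theory.
Import numFieldNormedType.Exports.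
Local Open Scope classical_set_scope.
Local Open Scope ring_scope.
Local Open Scope complex_scope.

Set Implicit Arguments.
Unset Strict Implicit.
Unset Printing Implicit Defensive.

(** The sine transform
    [(S u)(y) = pi^-1 * \int_(-pi)^pi u(t, y) sin (k t) dt]
    intertwines the Laplacian in [(t, y)] with the Helmholtz operator
    [Delta_y - k^2], that is [(Delta_y - k^2) (S u) = S (Delta u)], as soon as
    [u] is C^2 on the strip and vanishes on the two lines [t = pi] and
    [t = -pi] ([helmholtz_cwint]).  Indeed the y-derivatives go through the
    integral ([is_derive_wint]), and two integrations by parts replace
    [\int u_tt sin (k t)] by [- k^2 \int u sin (k t)] ([wint_green]): the boundary
    terms in [u_t] are killed by [sin (k pi) = 0], those in [u] by the vanishing
    of [u].

    The identity is to be applied successively to [h, Delta h, ...,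
    Delta^(N-1) h], so that [(Delta_y - k^2)^N (S h) = S (Delta^N h) = 0].  Here
    oddness is what makes the induction go through ([iter_helmholtz_cwint]):
    vanishing at [t = pi] need not be inherited by the Laplacian, but oddness
    about [pi] is, since each t-derivative reverses parity and y-derivatives
    preserve it ([odd_at_laplacian]); and an odd function vanishes at its centre.

    Everything is done on real and imaginary parts.  Derivatives being
    directional, the exchange of derivative and integral rests on the mean value
    theorem along a line ([is_derive_line]) and on the compactness of [[-pi, pi]], which makes the continuity of
    [z |-> u (t, z)] uniform in [t] ([continuous_slices_uniform]). *)

(** * One-variable calculus and partial derivatives along slices *)

Section slices.
Context {R : realType} {V : normedModType R}.
Implicit Types (u : R * V -> R).

Lemma is_derive1_continuous (f : R -> R) (t df : R) :
  is_derive t 1 f df -> {for t, continuous f}.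
Proof.
by move=> [dt _]; apply: differentiable_continuous; exact/derivable1_diffP.
Qed.

(** The mean value theorem from 0 to [h] for either sign of [h], as the limit
    defining a derivative is two-sided. *)
Lemma increment_mean_value (phi dphi : R -> R) (h : R) :
  (forall s : R, is_derive s 1 phi (dphi s)) ->
  exists2 c, `|c| <= `|h| & phi h - phi 0 = dphi c * h.
Proof.
move=> dp.
have cphi (x y : R) : {within `[x, y], continuous phi}.
  by apply: continuous_subspaceT => s; apply: is_derive1_continuous; exact: dp.
case: (leP 0 h) => h0.
- have [c + E] := MVT_segment h0 (fun s _ => dp s) (cphi _ _).
  rewrite in_itv /= => /andP[c0 ch]; exists c; last by rewrite E subr0.
  by rewrite !ger0_norm.
- have [c + E] := MVT_segment (ltW h0) (fun s _ => dp s) (cphi _ _).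
  rewrite in_itv /= => /andP[hc c0]; exists c.
    by rewrite !ler0_norm ?lerN2 // ltW.
  by rewrite -opprB E sub0r mulrN opprK.
Qed.

(** A directional derivative is an ordinary derivative along the line it
    points to, at every point of that line; this is what lets one-variable
    theorems (mean value, FTC, chain rule) act on partial derivatives. *)
Lemma is_derive_line (W : normedModType R) (f : W -> R) (x v : W) (s : R) :
  derivable f (s *: v + x) v ->
  is_derive s 1 (fun r => f (r *: v + x)) ('D_v f (s *: v + x)).
Proof.
move=> df.
have E : (fun h : R => h^-1 *: (((fun r => f (r *: v + x)) \o shift s) (h *: 1)
           - f (s *: v + x)))
   = (fun h : R => h^-1 *: ((f \o shift (s *: v + x)) (h *: v)
           - f (s *: v + x))).
  by apply/funext => h /=; rewrite [h *: 1]mulr1 scalerDl addrA.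
by apply: DeriveDef; rewrite /derivable /derive E.
Qed.

Lemma is_derive_time_slice u (t : R) (y : V) :
  derivable u (t, y) (1, 0) ->
  is_derive t 1 (fun s => u (s, y)) ('D_(1, 0) u (t, y)).
Proof.
have E (s : R) : s *: (1, 0) + (0, y) = (s, y) :> R * V.
  by congr pair => /=; rewrite ?scaler0 ?add0r // addr0 [s *: 1]mulr1.
rewrite -E => /is_derive_line; rewrite E => H.
by apply: is_derive_eq; last reflexivity; move: H; under eq_fun do rewrite E.
Qed.

Lemma is_derive_space_slice u (t : R) (y e : V) :
  derivable u (t, y) (0, e) ->
  is_derive y e (fun z => u (t, z)) ('D_(0, e) u (t, y)).
Proof.
move=> du.
have E : (fun h : R => h^-1 *: (((fun z => u (t, z)) \o shift y) (h *: e)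
           - u (t, y)))
   = (fun h : R => h^-1 *: ((u \o shift (t, y)) (h *: (0, e)) - u (t, y))).
  by apply/funext => h /=; congr (_ *: (u _ - _));
    congr pair; rewrite /= scaler0 add0r.
by apply: DeriveDef; rewrite /derivable /derive E.
Qed.

End slices.

(** * Integrals depending on a parameter *)

Section weighted_integral.
Context {R : realType} {V : normedModType R}.
Variables (a b : R) (w : R -> R).
Hypotheses (ab : a < b) (w_cont : continuous w).
Implicit Types (u : R * V -> R) (y e : V).

(** The weight is kept separate from [u], although only their product is
    integrated, because derivatives in [y] act on [u] alone whereas
    integration by parts changes the weight. *)
Definition wint u y : R :=
  \int[lebesgue_measure]_(t in `[a, b]) (u (t, y) * w t).

Lemma continuous_itv_integrable (f : R -> R) :
  {within `[a, b], continuous f} ->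
  (@lebesgue_measure R).-integrable `[a, b] (EFin \o f).
Proof. by apply: continuous_compact_integrable; exact: segment_compact. Qed.

Lemma Rintegral_norm_le (f : R -> R) (M : R) :
  {within `[a, b], continuous f} -> (forall t, a <= t <= b -> `|f t| <= M) ->
  `|\int[lebesgue_measure]_(t in `[a, b]) f t| <= M * (b - a).
Proof.
move=> cf fM.
have mD : measurable (`[a, b]%classic : set (measurableTypeR R)).
  exact: measurable_itv.
have fi := continuous_itv_integrable cf.
have Nfi : (@lebesgue_measure R).-integrable `[a, b] (EFin \o (fun t => `|f t|)).
  by have := integrable_norm fi.
have Mi : (@lebesgue_measure R).-integrable `[a, b] (EFin \o (cst M)).
  apply: continuous_itv_integrable.
  by apply: continuous_subspaceT => x; exact: cvg_cst.
apply: (le_trans (le_normr_Rintegral mD fi)).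
apply: (@le_trans _ _ (\int[lebesgue_measure]_(t in `[a, b]) (cst M) t)).
  by apply: le_Rintegral => // t; rewrite /= in_itv /=; exact: fM.
rewrite /cst Rintegral_cst //= lebesgue_measure_itv /= lte_fin ab.
by rewrite -EFinB.
Qed.

Lemma slice_continuous u y :
  (forall t, a <= t <= b -> {for (t, y), continuous u}) ->
  {within `[a, b], continuous (fun t => u (t, y) * w t)}.
Proof.
move=> cu; apply: continuous_in_subspaceT => t.
rewrite inE /= in_itv /= => tab.
apply: cvgM; last exact: w_cont.
apply: (@continuous_comp _ _ _ (fun t => (t, y)) u); last exact: cu.
exact: (cvg_pair cvg_id (cvg_cst y)).
Qed.

Lemma wint_integrable u y :
  (forall t, a <= t <= b -> {for (t, y), continuous u}) ->
  (@lebesgue_measure R).-integrable `[a, b]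
    (EFin \o (fun t => u (t, y) * w t)).
Proof.
by move=> cu; apply: continuous_itv_integrable; exact: slice_continuous.
Qed.

(** The tube lemma: joint continuity along the compact segment
    [[a, b] x {y}] controls a whole neighbourhood of it, whose width does not
    depend on [t]. *)
Lemma continuous_slices_uniform u y :
  (forall t, a <= t <= b -> {for (t, y), continuous u}) ->
  forall eps, 0 < eps ->
  \forall z \near y, forall t, a <= t <= b -> `|u (t, z) - u (t, y)| <= eps.
Proof.
move=> cu eps eps0.
have /compact_near_coveringP/near_covering_withinP K := @segment_compact R a b.
suff /K : forall t, `[a, b]%classic t -> \forall s \near t & z \near nbhs y,
    `[a, b]%classic s -> `|u (s, z) - u (s, y)| <= eps.
  by apply: filterS => z Hz t tab; apply: Hz; rewrite /= in_itv.
move=> t; rewrite /= in_itv /= => tab.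
have /cvgrPdist_le /(_ (eps / 2)) := cu t tab.
rewrite divr_gt0 // => /(_ isT) [[A B]] /= [tA yB] AB.
exists (A, B) => //= -[s z] /= [As Bz] _.
have h1 := AB (s, z) (conj As Bz).
have h2 := AB (s, y) (conj As (nbhs_singleton yB)).
rewrite (splitr eps) -(subrKA (u (t, y))).
by apply: le_trans (ler_normD _ _) _; rewrite lerD // distrC.
Qed.

Lemma weight_continuous u (t : R) (y : V) :
  {for (t, y), continuous u} ->
  {for (t, y), continuous (fun p => u p * w p.1)}.
Proof.
move=> cu; apply: cvgM; first exact: cu.
apply: (@continuous_comp _ _ _ fst w); last exact: w_cont.
exact: cvg_fst.
Qed.

Lemma wint_continuous u y :
  (forall t z, a <= t <= b -> {for (t, z), continuous u}) ->
  {for y, continuous (wint u)}.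
Proof.
move=> cu; apply/cvgrPdist_le => eps eps0.
have ba0 : 0 < b - a by rewrite subr_gt0.
have cuw t : a <= t <= b -> {for (t, y), continuous (fun p => u p * w p.1)}.
  by move=> tab; apply: weight_continuous; exact: cu.
have := continuous_slices_uniform cuw (divr_gt0 eps0 ba0).
apply: filterS => z Hz.
rewrite distrC /wint -RintegralB //; last 2 first.
- by apply: wint_integrable => t; exact: cu.
- by apply: wint_integrable => t; exact: cu.
rewrite -[leRHS](divfK (lt0r_neq0 ba0)).
apply: Rintegral_norm_le; last exact: Hz.
by move=> x; apply: cvgB; apply: slice_continuous => t; exact: cu.
Qed.

(** Differentiation under the integral sign.  By the mean value theorem the
    difference quotient of [u (t, _)] is the partial derivative at an
    intermediate point [c *: e + y] with [|c| <= |h|], hence uniformly close in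
    [t] to its value at [y]. *)
Lemma is_derive_wint u y e :
  (forall t z, a <= t <= b -> {for (t, z), continuous u}) ->
  (forall t z, a <= t <= b -> derivable u (t, z) (0, e)) ->
  (forall t z, a <= t <= b -> {for (t, z), continuous ('D_(0, e) u)}) ->
  is_derive y e (wint u) (wint ('D_(0, e) u) y).
Proof.
move=> cu du cdu.
have ba0 : 0 < b - a by rewrite subr_gt0.
suff H : h^-1 *: ((wint u \o shift y) (h *: e) - wint u y) @[h --> 0^'] -->
    wint ('D_(0, e) u) y.
  split; [by apply/cvg_ex; eexists; exact: H | exact: cvg_lim H].
apply/cvgrPdist_le => eps eps0.
have cuw t : a <= t <= b ->
    {for (t, y), continuous (fun p => 'D_(0, e) u p * w p.1)}.
  by move=> tab; apply: weight_continuous; exact: cdu.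
(* Applied to the product with the weight, the uniform estimate bounds the
   integrand itself, so [eps / (b - a)] is the right tolerance. *)
have U := continuous_slices_uniform cuw (divr_gt0 eps0 ba0).
have line : (fun c : R => c *: e + y) c @[c --> 0] --> y.
  rewrite -[X in _ --> X]add0r -(scale0r e).
  by apply: cvgD; [apply: cvgZr_tmp; exact: cvg_id | exact: cvg_cst].
have /nbhs_ballP[r /= r0 Hr] := line _ U.
apply/nbhs_ballP; exists r => //= h Bh h0.
rewrite distrC /wint /=.
have cF : {within `[a, b], continuous
    (fun t => u (t, h *: e + y) * w t - u (t, y) * w t)}.
  by move=> t; apply: cvgB; apply: slice_continuous => ?; exact: cu.
have cD : {within `[a, b], continuous (fun t => 'D_(0, e) u (t, y) * w t)}.
  by apply: (@slice_continuous ('D_(0, e) u)) => ?; exact: cdu.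
have cQ : {within `[a, b], continuous
    (fun t => h^-1 * (u (t, h *: e + y) * w t - u (t, y) * w t))}.
  by move=> t; apply: cvgM; [exact: cvg_cst | exact: cF].
rewrite -RintegralB //; try by apply: wint_integrable => t; exact: cu.
rewrite [X in X - _](_ : _ = \int[lebesgue_measure]_(t in `[a, b])
    (h^-1 * (u (t, h *: e + y) * w t - u (t, y) * w t))); last first.
  by rewrite RintegralZl //; exact: continuous_itv_integrable.
rewrite -RintegralB //; try exact: continuous_itv_integrable.
rewrite -[leRHS](divfK (lt0r_neq0 ba0)).
apply: Rintegral_norm_le => [t|t tab].
  by apply: cvgB; [exact: cQ | exact: cD].
have shE (c : R) : c *: (0, e) + (t, y) = (t, c *: e + y) :> R * V.
  by congr pair => /=; rewrite scaler0 add0r.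
have [] := @increment_mean_value R (fun c => u (c *: (0, e) + (t, y)))
  (fun c => 'D_(0, e) u (c *: (0, e) + (t, y))) h.
  by move=> s; apply: is_derive_line; rewrite shE; exact: du.
move=> c ch; rewrite !shE scale0r add0r => E.
rewrite -mulrBl mulrA E mulrCA mulVf // mulr1.
apply: (Hr c) => //.
by move: Bh; rewrite /= /ball /= !sub0r !normrN; exact: le_lt_trans.
Qed.

Lemma wint_ext u v y :
  (forall t, a <= t <= b -> u (t, y) = v (t, y)) -> wint u y = wint v y.
Proof.
move=> uv; apply: eq_Rintegral => t; rewrite inE /= in_itv /= => tab.
by rewrite uv.
Qed.

Lemma wintD u v y :
  (forall t, a <= t <= b -> {for (t, y), continuous u}) ->
  (forall t, a <= t <= b -> {for (t, y), continuous v}) ->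
  wint (fun p => u p + v p) y = wint u y + wint v y.
Proof.
move=> cu cv; rewrite /wint -RintegralD //; try exact: wint_integrable.
by apply: eq_Rintegral => t _; rewrite mulrDl.
Qed.

End weighted_integral.

(** * Integration by parts in time *)

Section green.
Context {R : realType} {V : normedModType R}.
Implicit Types (u : R * V -> R).

(** Green's second identity on [[a, b]]: [u_tt w - u w''] is the derivative of
    [u_t w - u w'], and the latter vanishes at both ends when [u] and [w] do. *)
Lemma wint_green (a b : R) (w w1 w2 : R -> R) u (y : V) : a < b ->
  continuous w2 ->
  (forall t : R, is_derive t 1 w (w1 t)) ->
  (forall t : R, is_derive t 1 w1 (w2 t)) ->
  (forall t, a <= t <= b -> {for (t, y), continuous u}) ->
  (forall t, a <= t <= b -> derivable u (t, y) (1, 0)) ->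
  (forall t, a <= t <= b -> derivable ('D_(1, 0) u) (t, y) (1, 0)) ->
  (forall t, a <= t <= b -> {for (t, y), continuous ('D_(1, 0) ('D_(1, 0) u))}) ->
  w a = 0 -> w b = 0 -> u (a, y) = 0 -> u (b, y) = 0 ->
  wint a b w ('D_(1, 0) ('D_(1, 0) u)) y = wint a b w2 u y.
Proof.
move=> ab cw2 dw dw1 cu du ddu cddu wa wb ua ub.
have cw : continuous w.
  by move=> t; apply: is_derive1_continuous; exact: dw.
pose F t := 'D_(1, 0) u (t, y) * w t - u (t, y) * w1 t.
pose f t := 'D_(1, 0) ('D_(1, 0) u) (t, y) * w t - u (t, y) * w2 t.
have dF t : a <= t <= b -> is_derive t 1 F (f t).
  move=> tab.
  have d0 := is_derive_time_slice (du t tab).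
  have d1 := is_derive_time_slice (ddu t tab).
  have dwt := dw t; have dw1t := dw1 t.
  apply: is_derive_eq; rewrite /f /GRing.scale /=; ring.
have cf : {within `[a, b], continuous f}.
  move=> t; apply: cvgB; last by apply: (slice_continuous cw2 cu).
  exact: (slice_continuous cw cddu).
have cF t : a <= t <= b -> {for t, continuous F}.
  by move=> tab; apply: is_derive1_continuous; exact: dF.
have FTC : (\int[lebesgue_measure]_(t in `[a, b]) (f t)%:E
    = (F b)%:E - (F a)%:E)%E.
  apply: continuous_FTC2 => //.
    split.
    - move=> t; rewrite in_itv /= => /andP[ta tb].
      by apply: (@ex_derive _ _ _ _ _ _ _ (dF t _)); rewrite !ltW.
    - by apply: cvg_at_right_filter; apply: cF; rewrite lexx ltW.
    - by apply: cvg_at_left_filter; apply: cF; rewrite lexx ltW.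
  move=> t; rewrite in_itv /= => /andP[ta tb]; rewrite derive1E.
  by apply: (@derive_val _ _ _ _ _ _ _ (dF t _)); rewrite !ltW.
apply/subr0_eq; rewrite /wint -RintegralB //; last 2 first.
- exact: (wint_integrable cw cddu).
- exact: (wint_integrable cw2 cu).
by rewrite /Rintegral FTC /F wa wb ua ub -EFinB /= !mulr0 !mul0r !subr0.
Qed.

End green.

(** * Stability of the class C^n on an open set *)

Section Cn_on_theory.
Context {R : realType} {V : normedModType R} {I : finType}.
Variables (e : I -> V) (G : set V).
Hypothesis G_open : open G.
Implicit Types (f g : V -> R[i]) (x v : V).

Lemma near_open_add f g k x : (forall z, G z -> k z = f z + g z) -> G x ->
  (\forall z \near x, cre f z + cre g z = cre k z) /\
  (\forall z \near x, cim f z + cim g z = cim k z).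
Proof.
move=> kE Gx; have Gn : \forall z \near x, G z by exact: open_nbhs_nbhs.
by split; apply: filterS Gn => z /kE; rewrite /cre /cim => ->;
  case: (f z) (g z) => [? ?] [? ?].
Qed.

Lemma Cn_on_continuous n f : Cn_on e n G f -> ccontinuous_on G f.
Proof. by case: n => [//|n []]. Qed.

(** [k] is only assumed to agree with [f + g] on [G]: the derivative of a sum
    is the sum of the derivatives only where both exist, so the induction on [n]
    has to be closed under modifications outside [G]. *)
Lemma Cn_on_add n f g k : (forall x, G x -> k x = f x + g x) ->
  Cn_on e n G f -> Cn_on e n G g -> Cn_on e n G k.
Proof.
have cont f0 g0 k0 : (forall x, G x -> k0 x = f0 x + g0 x) ->
    ccontinuous_on G f0 -> ccontinuous_on G g0 -> ccontinuous_on G k0.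
  move=> kE cf cg x Gx; have [nr ni] := near_open_add kE Gx.
  have [[fr fi] [gr gi]] := (cf x Gx, cg x Gx).
  split.
  - rewrite /prop_for /continuous_at -(nbhs_singleton nr).
    by apply: cvg_trans (cvgD fr gr); exact: near_eq_cvg.
  - rewrite /prop_for /continuous_at -(nbhs_singleton ni).
    by apply: cvg_trans (cvgD fi gi); exact: near_eq_cvg.
elim: n f g k => [|n IH] f g k kE; first exact: cont.
move=> [cf df Df] [cg dg Dg]; split; first exact: (cont f g).
  move=> i x Gx; have [nr ni] := near_open_add kE Gx.
  have [[fr fi] [gr gi]] := (df i x Gx, dg i x Gx).
  by split; [apply: near_eq_derivable nr _ | apply: near_eq_derivable ni _];
    exact: derivableD.
move=> i; apply: IH (Df i) (Dg i) => x Gx.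
have [nr ni] := near_open_add kE Gx.
have [[fr fi] [gr gi]] := (df i x Gx, dg i x Gx).
rewrite /cderive -(near_eq_derive _ nr) -(near_eq_derive _ ni).
by rewrite (deriveD fr gr) (deriveD fi gi).
Qed.

Lemma Cn_on_0 n : Cn_on e n G (fun=> 0).
Proof.
have cont : ccontinuous_on G (fun=> 0 : R[i]).
  by move=> x _; split; exact: cvg_cst.
elim: n => [|n IH] //=; split => // [i x _|i].
  by split; exact: derivable_cst.
suff -> : cderive (e i) (fun=> 0 : R[i]) = fun=> 0 by [].
by apply/funext => x; rewrite /cderive /cre /cim !derive_cst.
Qed.

Lemma Cn_on_sum n (J : Type) (r : seq J) (F : J -> V -> R[i]) :
  (forall j, Cn_on e n G (F j)) ->
  Cn_on e n G (fun x => \sum_(j <- r) F j x).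
Proof.
move=> CF; elim: r => [|j r IH].
  by under eq_fun do rewrite big_nil; exact: Cn_on_0.
by apply: Cn_on_add (CF j) IH => x _; rewrite big_cons.
Qed.

Lemma Cn_on_laplacian n f :
  Cn_on e n.+2 G f -> Cn_on e n G (laplacian e f).
Proof. by case=> _ _ Df; apply: Cn_on_sum => i; case: (Df i) => _ _; exact. Qed.

End Cn_on_theory.

(** * Parity in time and partial derivatives *)

Section parity.
Context {R : realType} {V : normedModType R}.
Variables (t0 m : R).
Implicit Types (u : R * V -> R) (s : R).

(** [s = -1] is oddness about [t0] and [s = 1] evenness; a general factor [s]
    lets one lemma serve for both steps from [u] to [u_tt]. *)
Definition parity s u :=
  forall t y, `|t| < m -> u (t0 + t, y) = s * u (t0 - t, y).

Lemma parity_space_derive s u (e : V) :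
  (forall t y, `|t| < m -> derivable u (t0 + t, y) (0, e)) ->
  parity s u -> parity s ('D_(0, e) u).
Proof.
move=> du pu t y tm.
have d1 := is_derive_space_slice (du t y tm).
have d2 : is_derive y e (fun z => u (t0 - t, z)) ('D_(0, e) u (t0 - t, y)).
  by apply: is_derive_space_slice; apply: du; rewrite normrN.
rewrite -(@derive_val _ _ _ _ _ _ _ d1).
rewrite -(@derive_val _ _ _ _ _ _ _ d2).
rewrite (_ : (fun z => u (t0 + t, z)) = s \*: (fun z => u (t0 - t, z))).
  by rewrite deriveZ.
by apply/funext => z; rewrite pu.
Qed.

Lemma parity_time_derive s u :
  (forall t y, `|t| < m -> derivable u (t0 + t, y) (1, 0)) ->
  parity s u -> parity (- s) ('D_(1, 0) u).
Proof.
move=> du pu t y tm.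
have d1 := is_derive_time_slice (du t y tm).
have Ntm : `|- t| < m by rewrite normrN.
have d2 := is_derive_time_slice (du (- t) y Ntm).
(* Near [t0 + t], [u] is [s] times its composite with the reflection
   [r |-> 2 * t0 - r], whose derivative -1 produces the change of sign. *)
have d3 : is_derive (t0 + t) 1 (fun r : R => 2 * t0 - r) (- 1).
  by apply: is_derive_eq; ring.
have E2 : 2 * t0 - (t0 + t) = t0 - t by ring.
have d2' : is_derive (2 * t0 - (t0 + t)) 1 (fun r => u (r, y))
    ('D_(1, 0) u (t0 - t, y)) by rewrite E2.
have d4 := is_deriveZ s (@is_derive1_comp _
  (fun r => u (r, y)) (fun r => 2 * t0 - r) _ _ _ d2' d3).
have nE : \forall r \near t0 + t, u (r, y) = s * u (2 * t0 - r, y).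
  apply/nbhs_ballP; exists (m - `|t|) => /=; first by rewrite subr_gt0.
  move=> r; rewrite /ball /= => Hr.
  have -> : 2 * t0 - r = t0 - (r - t0) by ring.
  rewrite -pu; first by congr u; congr pair => /=; ring.
  have -> : r - t0 = t - (t0 + t - r) by ring.
  by apply: le_lt_trans (ler_normB _ _) _; rewrite -ltrBrDl.
rewrite -(@derive_val _ _ _ _ _ _ _ d1) (near_eq_derive _ nE).
rewrite (@derive_val _ _ _ _ _ _ _ d4) /GRing.scale /=; ring.
Qed.

End parity.

(** * The sine weight *)

Section sine_weight.
Context {R : realType}.
Implicit Types (k : nat) (t : R).

(** The factor [pi^-1] is part of the weight, so that [sine_coef] becomes an
    instance of [wint] on real and imaginary parts. *)
Definition sine_weight (k : nat) (t : R) : R := pi^-1 * sin (k%:R * t).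

Lemma is_derive_mull k t :
  is_derive t 1 (fun r : R => k%:R * r) k%:R.
Proof. by apply: is_derive_eq; rewrite /GRing.scale /= mulr1. Qed.

Lemma is_derive_sin_mull k t :
  is_derive t 1 (fun r : R => sin (k%:R * r)) (cos (k%:R * t) * k%:R).
Proof.
exact: (@is_derive1_comp _ sin (fun r => k%:R * r) _ _ _ _ (is_derive_mull k t)).
Qed.

Lemma is_derive_sine_weight k t :
  is_derive t 1 (sine_weight k) (pi^-1 * (k%:R * cos (k%:R * t))).
Proof.
by rewrite [k%:R * cos _]mulrC; apply: is_deriveZ; exact: is_derive_sin_mull.
Qed.

Lemma is_derive_sine_weight1 k t :
  is_derive t 1 (fun r => pi^-1 * (k%:R * cos (k%:R * r)))
    (- k%:R ^+ 2 * sine_weight k t).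
Proof.
have -> : - k%:R ^+ 2 * sine_weight k t =
    pi^-1 * (k%:R * (- sin (k%:R * t) * k%:R)).
  by rewrite /sine_weight; ring.
do 2 apply: is_deriveZ.
exact: (@is_derive1_comp _ cos (fun r => k%:R * r) _ _ _ _ (is_derive_mull k t)).
Qed.

Lemma sin_nat_pi k : sin (k%:R * pi) = 0 :> R.
Proof.
elim: k => [|k IH]; first by rewrite mul0r sin0.
by rewrite -natr1 mulrDl mul1r sinDpi IH oppr0.
Qed.

Lemma sine_weight_continuous k : continuous (sine_weight k).
Proof.
by move=> t; apply: is_derive1_continuous; exact: is_derive_sine_weight.
Qed.

Lemma sine_weight_pi k : sine_weight k pi = 0.
Proof. by rewrite /sine_weight sin_nat_pi mulr0. Qed.

Lemma sine_weight_Npi k : sine_weight k (- pi) = 0.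
Proof. by rewrite /sine_weight mulrN sinN sin_nat_pi oppr0 mulr0. Qed.

End sine_weight.

(** * Sine coefficients and the Helmholtz operator *)

Lemma sum_option (W : nmodType) (I : finType) (F : option I -> W) :
  \sum_(i : option I) F i = F None + \sum_(j : I) F (Some j).
Proof.
rewrite (bigD1 None) //=; congr (_ + _).
by rewrite (reindex_omap Some id) => [|[]] //=; apply: eq_bigl => j; rewrite eqxx.
Qed.

Section sine_coefficients.
Context {R : realType} {d : nat}.
Variables (delta : R).
Hypothesis delta_gt0 : 0 < delta.
Let G : set (R * 'rV[R]_d) := strip (- pi - delta) (pi + delta).
Let odd_about (t0 : R) (u : R * 'rV[R]_d -> R[i]) :=
  odd_at (- pi - delta) (pi + delta) t0 u.
Let radius (t0 : R) : R := Num.min (pi + delta - t0) (t0 - (- pi - delta)).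
Implicit Types (u : R * 'rV[R]_d -> R[i]) (w : R -> R) (y : 'rV[R]_d).

Let Npi_lt_pi : - pi < pi :> R.
Proof. by rewrite -subr_gt0 opprK addr_gt0 ?pi_gt0. Qed.

Lemma strip_open (a b : R) : open (@strip R d a b).
Proof.
rewrite (_ : strip a b = fst @^-1` (`]a, b[%classic : set R)).
  by apply: open_comp => [p _|]; [exact: cvg_fst | exact: interval_open].
by apply/seteqP; split => p; rewrite /strip /= in_itv.
Qed.

Lemma strip_period t y : - pi <= t <= pi -> G (t, y).
Proof.
move=> /andP[h1 h2]; rewrite /G /strip /=.
by apply/andP; split; have := delta_gt0; move: h1 h2; lra.
Qed.

Lemma odd_at_parity t0 u : odd_about t0 u <->
  parity t0 (radius t0) (- 1) (cre u) /\
  parity t0 (radius t0) (- 1) (cim u).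
Proof.
split=> [ou|[ore oim] t y tm].
  by split=> t y tm; rewrite /cre /cim (ou t y tm) mulN1r; case: (u _).
move: (ore t y tm) (oim t y tm); rewrite /cre /cim !mulN1r.
by case: (u _) (u _) => [? ?] [? ?] /= -> ->.
Qed.

(** Each second partial derivative of an odd function is odd: [d/dt] multiplies
    the parity factor by -1 twice, [d/dy_j] leaves it unchanged. *)
Lemma odd_at_laplacian t0 n u :
  Cn_on ty_basis n.+2 G u -> odd_about t0 u ->
  odd_about t0 (laplacian ty_basis u).
Proof.
move=> [_ du Du] ou t y tm; rewrite /laplacian -sumrN; apply: eq_bigr => i _.
move: t y tm; case: (Du i) => _ ddu _.
have Gm t y : `|t| < radius t0 -> G (t0 + t, y).
  rewrite /radius lt_min !ltr_norml => /andP[/andP[h1 h2] /andP[h3 h4]].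
  by rewrite /G /strip /=; apply/andP; split; lra.
move/odd_at_parity : ou => [ore oim].
change (odd_about t0 (cderive (ty_basis i) (cderive (ty_basis i) u))).
apply/odd_at_parity; case: i ddu => [j|] ddu.
  split.
  - apply: (parity_space_derive (u := 'D_(0, y_basis j) (cre u))) => [t y tm|].
      exact: (ddu (Some j) _ (Gm _ _ tm)).1.
    apply: parity_space_derive ore => t y tm.
    exact: (du (Some j) _ (Gm _ _ tm)).1.
  - apply: (parity_space_derive (u := 'D_(0, y_basis j) (cim u))) => [t y tm|].
      exact: (ddu (Some j) _ (Gm _ _ tm)).2.
    apply: parity_space_derive oim => t y tm.
    exact: (du (Some j) _ (Gm _ _ tm)).2.
split; rewrite -[- 1 as X in parity _ _ X]opprK.
- apply: (parity_time_derive (u := 'D_(1, 0) (cre u))) => [t y tm|].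
    exact: (ddu None _ (Gm _ _ tm)).1.
  apply: parity_time_derive ore => t y tm.
  exact: (du None _ (Gm _ _ tm)).1.
- apply: (parity_time_derive (u := 'D_(1, 0) (cim u))) => [t y tm|].
    exact: (ddu None _ (Gm _ _ tm)).2.
  apply: parity_time_derive oim => t y tm.
  exact: (du None _ (Gm _ _ tm)).2.
Qed.

Lemma odd_at_eq0 t0 u y : - pi <= t0 <= pi -> odd_about t0 u -> u (t0, y) = 0.
Proof.
move=> /andP[h1 h2] /(_ 0 y); rewrite normr0 addr0 subr0 => ou.
have : u (t0, y) = - u (t0, y).
  by apply: ou; rewrite lt_min; apply/andP; split; have := delta_gt0; lra.
by move/eqP; rewrite -subr_eq0 opprK -mulr2n -mulr_natr mulf_eq0 pnatr_eq0 orbF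
  => /eqP.
Qed.

Definition cwint w u y : R[i] :=
  wint (- pi) pi w (cre u) y +i* wint (- pi) pi w (cim u) y.

Lemma ccontinuous_period u : ccontinuous_on G u ->
  (forall t y, - pi <= t <= pi -> {for (t, y), continuous (cre u)}) /\
  (forall t y, - pi <= t <= pi -> {for (t, y), continuous (cim u)}).
Proof. by move=> cu; split=> t y /(@strip_period t y) /cu[]. Qed.

Section weight.
Variable w : R -> R.
Hypothesis w_cont : continuous w.

(** The equality of functions holds on the whole space, not only near a point,
    because the strip contains all of [[-pi, pi] x R^d]; hence it can be
    iterated by plain rewriting. *)
Lemma cderive_cwint n u (j : 'I_d) : Cn_on ty_basis n.+1 G u ->
  (forall y, cderivable (cwint w u) y (y_basis j)) /\
  cderive (y_basis j) (cwint w u) = cwint w (cderive (ty_basis (Some j)) u).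
Proof.
move=> [/ccontinuous_period[cr ci] du Du].
have [Cr Ci] := ccontinuous_period (Cn_on_continuous (Du (Some j))).
have dr y : is_derive y (y_basis j) (wint (- pi) pi w (cre u))
    (wint (- pi) pi w ('D_(0, y_basis j) (cre u)) y).
  apply: is_derive_wint => // t z tp.
  exact: (du (Some j) _ (strip_period z tp)).1.
have di y : is_derive y (y_basis j) (wint (- pi) pi w (cim u))
    (wint (- pi) pi w ('D_(0, y_basis j) (cim u)) y).
  apply: is_derive_wint => // t z tp.
  exact: (du (Some j) _ (strip_period z tp)).2.
split=> [y|].
  by split; [exact: (@ex_derive _ _ _ _ _ _ _ (dr y))
            | exact: (@ex_derive _ _ _ _ _ _ _ (di y))].
apply/funext => y; rewrite /cderive /cwint.
by congr Complex; [exact: (@derive_val _ _ _ _ _ _ _ (dr y))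
            | exact: (@derive_val _ _ _ _ _ _ _ (di y))].
Qed.

Lemma Cn_on_cwint n u :
  Cn_on ty_basis n G u -> Cn_on y_basis n setT (cwint w u).
Proof.
have cont v : ccontinuous_on G v -> ccontinuous_on setT (cwint w v).
  by move=> /ccontinuous_period[cr ci] y _; split; exact: wint_continuous.
elim: n u => [|n IH] u Cu; first exact: cont.
split; first by apply: cont; exact: Cn_on_continuous Cu.
  by move=> j y _; exact: (cderive_cwint j Cu).1.
by move=> j; rewrite (cderive_cwint j Cu).2; apply: IH; case: Cu => _ _; exact.
Qed.

Lemma cwint_eq0 u y :
  (forall t, - pi <= t <= pi -> u (t, y) = 0) -> cwint w u y = 0.
Proof.
have wint0 (v : R * 'rV[R]_d -> R) : (forall t, - pi <= t <= pi -> v (t, y) = 0) ->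
    wint (- pi) pi w v y = 0.
  move=> v0; transitivity
      (\int[@lebesgue_measure R]_(t in `[- pi, pi]) (cst 0 : R -> R) t).
    apply: eq_Rintegral => t; rewrite inE /= in_itv /= => tp.
    by rewrite v0 // mul0r.
  by rewrite Rintegral_cst ?mul0r //; exact: measurable_itv.
by move=> u0; rewrite /cwint !wint0 // => t tp; rewrite /cre /cim u0.
Qed.

Lemma cwint_sum (J : Type) (r : seq J) (F : J -> R * 'rV[R]_d -> R[i]) y :
  (forall j, ccontinuous_on G (F j)) ->
  cwint w (fun p => \sum_(j <- r) F j p) y = \sum_(j <- r) cwint w (F j) y.
Proof.
move=> cF; elim: r => [|j r IH].
  by rewrite big_nil; apply: cwint_eq0 => t _; rewrite big_nil.
rewrite big_cons -IH.
have [fr fi] := ccontinuous_period (cF j).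
have [gr gi] := ccontinuous_period
  (@Cn_on_sum _ _ _ ty_basis G (@strip_open _ _) 0 _ r F cF).
rewrite /cwint /=; congr Complex; rewrite -wintD //;
  try (by move=> t tp; move: tp;
          first [exact: fr | exact: fi | exact: gr | exact: gi]);
  by apply: wint_ext => t tp; rewrite /cre /cim big_cons;
    case: (F j _) (\sum_(_ <- _) _) => [? ?] [? ?].
Qed.

End weight.

Lemma wint_sine_dtt k (v : R * 'rV[R]_d -> R) y :
  (forall t, - pi <= t <= pi -> {for (t, y), continuous v}) ->
  (forall t, - pi <= t <= pi -> derivable v (t, y) (1, 0)) ->
  (forall t, - pi <= t <= pi -> derivable ('D_(1, 0) v) (t, y) (1, 0)) ->
  (forall t, - pi <= t <= pi ->
     {for (t, y), continuous ('D_(1, 0) ('D_(1, 0) v))}) ->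
  v (- pi, y) = 0 -> v (pi, y) = 0 ->
  wint (- pi) pi (sine_weight k) ('D_(1, 0) ('D_(1, 0) v)) y =
  - k%:R ^+ 2 * wint (- pi) pi (sine_weight k) v y.
Proof.
move=> cv dv ddv cddv va vb.
rewrite (@wint_green _ _ _ _ _ _ (fun t => - k%:R ^+ 2 * sine_weight k t) _ _
  Npi_lt_pi _ (is_derive_sine_weight k) (is_derive_sine_weight1 k)) //;
  rewrite ?sine_weight_pi ?sine_weight_Npi //.
  rewrite /wint -RintegralZl; last 2 first.
  - exact: measurable_itv.
  - exact: (wint_integrable (@sine_weight_continuous R k) cv).
  by apply: eq_Rintegral => t _; rewrite mulrCA.
by move=> t; apply: cvgM; [exact: cvg_cst | exact: sine_weight_continuous].
Qed.

(** In the integral of [Delta u] the space part is [Delta_y] of the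
    coefficient, and the time part is [- k^2] times the coefficient by
    integration by parts: the two together are the Helmholtz operator. *)
Lemma helmholtz_cwint n k u :
  Cn_on ty_basis n.+2 G u -> odd_about pi u -> odd_about (- pi) u ->
  helmholtz y_basis k (cwint (sine_weight k) u) =
  cwint (sine_weight k) (laplacian ty_basis u).
Proof.
move=> Cu ou oNu; apply/funext => y.
have cw := @sine_weight_continuous R k.
have [cu du Du] := Cu.
rewrite /helmholtz /laplacian cwint_sum //; last first.
  by move=> i; case: (Du i) => _ _ DDu; exact: Cn_on_continuous (DDu i).
(* Aligns the time derivatives, [None], with the term [- k^2] of [helmholtz]. *)
rewrite sum_option addrC.
congr (_ + _).
  apply: eq_bigr => j _; rewrite (cderive_cwint cw j Cu).2.
  by rewrite (cderive_cwint cw j (Du (Some j))).2.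
have [cr ci] := ccontinuous_period cu.
have [_ ddu DDu] := Du None.
have [Cr Ci] := ccontinuous_period (Cn_on_continuous (DDu None)).
have pp : - pi <= (pi : R) <= pi by rewrite lexx andbT ltW.
have pm : - pi <= (- pi : R) <= pi by rewrite lexx ltW.
have u0 : u (pi, y) = 0 by exact: odd_at_eq0.
have uN0 : u (- pi, y) = 0 by exact: odd_at_eq0.
have Er : wint (- pi) pi (sine_weight k) ('D_(1, 0) ('D_(1, 0) (cre u))) y =
    - k%:R ^+ 2 * wint (- pi) pi (sine_weight k) (cre u) y.
  apply: wint_sine_dtt => [t tp|t tp|t tp|t tp||].
  - exact: cr.
  - exact: (du None _ (strip_period y tp)).1.
  - exact: (ddu None _ (strip_period y tp)).1.
  - exact: Cr.
  - by rewrite /cre uN0.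
  - by rewrite /cre u0.
have Ei : wint (- pi) pi (sine_weight k) ('D_(1, 0) ('D_(1, 0) (cim u))) y =
    - k%:R ^+ 2 * wint (- pi) pi (sine_weight k) (cim u) y.
  apply: wint_sine_dtt => [t tp|t tp|t tp|t tp||].
  - exact: ci.
  - exact: (du None _ (strip_period y tp)).2.
  - exact: (ddu None _ (strip_period y tp)).2.
  - exact: Ci.
  - by rewrite /cim uN0.
  - by rewrite /cim u0.
have -> : cwint (sine_weight k) (cderive (ty_basis None)
     (cderive (ty_basis None) u)) y =
   (- k%:R ^+ 2 * wint (- pi) pi (sine_weight k) (cre u) y) +i*
   (- k%:R ^+ 2 * wint (- pi) pi (sine_weight k) (cim u) y).
  by congr Complex; [exact: Er | exact: Ei].
have -> : k%:R = (k%:R : R)%:C :> R[i] by rewrite rmorph_nat.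
rewrite -rmorphXn /=.
by congr Complex; rewrite /=; ring.
Qed.

(** Induction on [N] over all functions that are odd about both ends: the
    Laplacian stays in this class, at the cost of two orders of
    differentiability. *)
Lemma iter_helmholtz_cwint N k u :
  Cn_on ty_basis (2 * N) G u -> odd_about pi u -> odd_about (- pi) u ->
  (forall p, G p -> iter N (laplacian ty_basis) u p = 0) ->
  forall y, iter N (helmholtz y_basis k) (cwint (sine_weight k) u) y = 0.
Proof.
elim: N u => [|N IH] u Cu ou oNu Lu y.
  by apply: cwint_eq0 => t tp; apply: Lu; exact: strip_period.
move: Cu; rewrite mulnS => Cu.
rewrite iterSr (helmholtz_cwint k Cu ou oNu); apply: IH.
- by apply: Cn_on_laplacian; [exact: strip_open | exact: Cu].
- exact: odd_at_laplacian Cu ou.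
- exact: odd_at_laplacian Cu oNu.
- by move=> p Gp; rewrite -iterSr; exact: Lu.
Qed.

Lemma sine_coefE k u : ccontinuous_on G u ->
  sine_coef u k = cwint (sine_weight k) u.
Proof.
move=> /ccontinuous_period[cr ci]; apply/funext => y.
have sc : continuous (fun t : R => sin (k%:R * t)).
  by move=> t; exact: (is_derive1_continuous (is_derive_sin_mull k t)).
have E (v : R * 'rV[R]_d -> R) :
    (forall t, - pi <= t <= pi -> {for (t, y), continuous v}) ->
    wint (- pi) pi (sine_weight k) v y =
    pi^-1 * \int[@lebesgue_measure R]_(t in `[- pi, pi]) (v (t, y) * sin (k%:R * t)).
  move=> cv; rewrite -RintegralZl; last 2 first.
  - exact: measurable_itv.
  - exact: (wint_integrable sc cv).
  by apply: eq_Rintegral => t _; rewrite /sine_weight mulrCA.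
rewrite /sine_coef /cwint (E _ (fun t => cr t y)) (E _ (fun t => ci t y)).
rewrite /cintegral.
have Ere : \int[@lebesgue_measure R]_(t in `[- pi, pi])
    complex.Re (u (t, y) * (sin (k%:R * t))%:C) =
  \int[@lebesgue_measure R]_(t in `[- pi, pi]) (cre u (t, y) * sin (k%:R * t)).
  by apply: eq_Rintegral => t _; rewrite /cre; case: (u _) => ? ? /=; ring.
have Eim : \int[@lebesgue_measure R]_(t in `[- pi, pi])
    complex.Im (u (t, y) * (sin (k%:R * t))%:C) =
  \int[@lebesgue_measure R]_(t in `[- pi, pi]) (cim u (t, y) * sin (k%:R * t)).
  by apply: eq_Rintegral => t _; rewrite /cim; case: (u _) => ? ? /=; ring.
by rewrite Ere Eim; congr Complex => /=; ring.
Qed.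

End sine_coefficients.

Theorem theorem1 (R : realType) (d N : nat) (delta : R)
    (h : R * 'rV[R]_d -> R[i])
    (d_ge1 : (1 <= d)%N) (N_ge1 : (1 <= N)%N) (delta_gt0 : 0 < delta)
    (h_polyharmonic :
      polyharmonic ty_basis N (strip (- pi - delta) (pi + delta)) h)
    (h_odd_0 : odd_at (- pi - delta) (pi + delta) 0 h)
    (h_odd_pi : odd_at (- pi - delta) (pi + delta) pi h)
    (h_odd_Npi : odd_at (- pi - delta) (pi + delta) (- pi) h) :
  forall k : nat, (1 <= k)%N ->
    Cn_on y_basis (2 * N) setT (sine_coef h k) /\
    forall y : 'rV[R]_d, iter N (helmholtz y_basis k) (sine_coef h k) y = 0.
Proof.
move=> k _; have [Ch Lh] := h_polyharmonic.
rewrite (sine_coefE delta_gt0 k (Cn_on_continuous Ch)); split.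
  by apply: Cn_on_cwint Ch => //; exact: sine_weight_continuous.
exact: iter_helmholtz_cwint Ch h_odd_pi h_odd_Npi Lh.
Qed.
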